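(* Let $k\ge 1$ and let $\Phi=(\varphi_j)_{j=1}^n$ be a $(d,n)$-ETF over $\mathbb{R}$ or $\mathbb{C}$ with $n>d$, with $k$-homogeneous line symmetry group and with $\operatorname{spark}(\Phi)\ge k$. Then the bender of $\Phi$ forms a $k$-design; that is, $(\{1,\dots,n\},\mathcal{B})$, with $\mathcal{B}$ the bender of $\Phi$, is a $k$-$(n,\operatorname{spark}(\Phi),\lambda)$-design for some $\lambda>0$.
   Context: A $(d,n)$-ETF (equiangular tight frame), $d\le n$, over $\mathbb{F}=\mathbb{R}$ or $\mathbb{C}$ is a sequence $\Phi=(\varphi_j)_{j=1}^n$ in $\mathbb{F}^d$ such that (i) there are $a\le b$, $b>0$, with $|\langle\varphi_j,\varphi_k\rangle|=(b-a)\delta_{j,k}+a$ for all $j,k$, and (ii) $\Phi\Phi^*=AI$ for some $A>0$, where $\Phi$ also denotes the $d\times n$ matrix with columns $\varphi_j$. For $n>d$, $\operatorname{spark}(\Phi)$ is the size of the smallest linearly dependent subset of vectors of $\Phi$ (subsets taken by index). The bender of $\Phi$ is the collection of all subsets of $\Phi$ (identified with their sets of indices in $\{1,\dots,n\}$) of size $\operatorname{spark}(\Phi)$ that are linearly dependent. The line symmetry group of $\Phi$ is the subgroup of $S_n$ of those $\sigma$ for which there is a unitary (orthogonal if $\mathbb{F}=\mathbb{R}$) $d\times d$ matrix $U$ with $U\varphi_j\varphi_j^*U^*=\varphi_{\sigma(j)}\varphi_{\sigma(j)}^*$ for all $j$. It is $k$-homogeneous if any $k$-element subset of $\{1,\dots,n\}$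 can be mapped by some element of the group onto any other $k$-element subset. A $t$-$(v,m,\lambda)$-design is a pair $(V,\mathcal{B})$ with $V$ a set of size $v$ and $\mathcal{B}$ a collection of subsets of $V$ (blocks), all of size $m$, such that every set of $t$ distinct elements of $V$ is contained in precisely $\lambda>0$ blocks. A $t$-design is such a pair for some parameters. *)

(* Defs.v *)
From HB Require Import structures.
From mathcomp Require Import all_boot all_order all_algebra all_fingroup.
From mathcomp Require Import boolp reals.
From mathcomp Require Import complex.

Set Implicit Arguments.
Unset Strict Implicit.
Unset Printing Implicit Defensive.

Import Order.TTheory GRing.Theory Num.Theory.
Local Open Scope ring_scope.
Local Open Scope sesquilinear_scope.

(* The real and complex cases are treated uniformly: theta is the conjugation
   of F, i.e. the identity when F is real and Num.conj when F is complex. The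
   frame Phi is the d x n matrix whose columns col j Phi are its vectors. *)
Section Frames.
Variables (F : numFieldType) (theta : involutive_rmorphism F).

Definition inner (d : nat) (u v : 'cV[F]_d) : F :=
  \sum_(i < d) u i 0 * theta (v i 0).

(* When F is complex, x <= y means that y - x is a nonnegative real; hence
   the constants a, b and A below are real. *)
Definition is_etf (d n : nat) (Phi : 'M[F]_(d, n)) : Prop :=
  [/\ (d <= n)%N,
      exists a b : F, [/\ a <= b, 0 < b &
        forall j k : 'I_n,
          `|inner (col j Phi) (col k Phi)| = (b - a) * (j == k)%:R + a]
    & exists2 A : F, 0 < A & Phi *m Phi ^t theta = A%:M].

Definition lin_dep (d n : nat) (Phi : 'M[F]_(d, n)) (S : {set 'I_n}) : bool :=
  ~~ free [seq col j Phi | j in S].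

(* Only meaningful for d < n, when the full index set is dependent, so that
   the minimum is taken over a nonempty family. *)
Definition spark (d n : nat) (Phi : 'M[F]_(d, n)) : nat :=
  #|[arg min_(S < [set: 'I_n] | lin_dep Phi S) #|S|]%N|.

Definition bender (d n : nat) (Phi : 'M[F]_(d, n)) : {set {set 'I_n}} :=
  [set S : {set 'I_n} | (#|S| == spark Phi) && lin_dep Phi S].

Definition is_unitary_mx (d : nat) (U : 'M[F]_d) : Prop :=
  U *m U ^t theta = 1%:M.

Definition line_proj (d n : nat) (Phi : 'M[F]_(d, n)) (j : 'I_n) : 'M[F]_d :=
  col j Phi *m (col j Phi) ^t theta.

Definition line_symmetry (d n : nat) (Phi : 'M[F]_(d, n)) (s : 'S_n) : Prop :=
  exists2 U : 'M[F]_d, is_unitary_mx U &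
    forall j, U *m line_proj Phi j *m U ^t theta = line_proj Phi (s j).

Definition line_symmetry_set (d n : nat) (Phi : 'M[F]_(d, n)) : {set 'S_n} :=
  [set s | `[< line_symmetry Phi s >]].

Lemma line_symmetry_group_set (d n : nat) (Phi : 'M[F]_(d, n)) :
  group_set (line_symmetry_set Phi).
Proof.
apply/group_setP; split=> [|s t].
  rewrite inE; apply/asboolP; exists 1%:M; first by
    rewrite /is_unitary_mx trmx1 map_mx1 mulmx1.
  by move=> j; rewrite trmx1 map_mx1 mulmx1 mul1mx perm1.
rewrite !inE => /asboolP[U U1 sU] /asboolP[W W1 tW].
apply/asboolP; exists (W *m U).
  by rewrite /is_unitary_mx trmx_mul map_mxM mulmxA -(mulmxA W) U1 mulmx1.
move=> j; rewrite permM -tW -sU trmx_mul map_mxM.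
by rewrite !mulmxA.
Qed.

Definition line_symmetry_group (d n : nat) (Phi : 'M[F]_(d, n)) :
  {group 'S_n} := Group (line_symmetry_group_set Phi).

End Frames.

Definition homogeneous (T : finType) (G : {group {perm T}}) (k : nat) : Prop :=
  forall A B : {set T}, #|A| = k -> #|B| = k ->
    exists2 s : {perm T}, s \in G & s @: A = B.

Definition is_design (t v m lambda : nat) (V : finType) (B : {set {set V}}) :
  Prop :=
  [/\ #|V| = v,
      forall b : {set V}, b \in B -> #|b| = m,
      (0 < lambda)%N
    & forall T : {set V}, #|T| = t -> #|[set b in B | T \subset b]| = lambda].

(* Main.v *)
Require Import Defs.
From HB Require Import structures.
From mathcomp Require Import all_boot all_order all_algebra all_fingroup.
From mathcomp Require Import boolp reals.
From mathcomp Require Import complex.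

(** The vectors of an equiangular frame are nonzero, their squared norm being
    b > 0. Nonzero vectors x and y with x x^* = y y^* are proportional, so a line
    symmetry s of Phi, realised by a unitary U, sends the vector of index j to
    the vector of index s j only up to a nonzero scalar:
    col (s j) Phi = c_j U (col j Phi) ([line_symmetry_col]). Linear dependence of
    a family is unaffected by an invertible map ([free_map_inj]) and by rescaling
    each vector ([free_map_scale]), hence s permutes the dependent index sets
    ([lin_dep_imset]), and in particular the bender.

    The rest is the classical fact that a k-homogeneous group of permutations
    turns an invariant family of blocks into a k-design ([homogeneous_design]):
    any k-set can be carried to any other, and the blocks containing the first
    are carried to blocks containing the second, so all k-sets lie in equally
    many blocks. That number is positive because the bender is nonempty, d < n
    forcing the n columns to be dependent, and its members have at least k
    elements. *)

Set Implicit Arguments.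
Unset Strict Implicit.
Unset Printing Implicit Defensive.

Import Order.TTheory GRing.Theory Num.Theory.
Local Open Scope ring_scope.
Local Open Scope sesquilinear_scope.

Lemma span_map_scale (F : fieldType) (V : vectType F) (I : Type) (c : I -> F)
    (f : I -> V) (s : seq I) : (forall i, c i != 0) ->
  (<<[seq c i *: f i | i <- s]>> = <<[seq f i | i <- s]>>)%VS.
Proof.
move=> c_neq0; elim: s => [|i s IHs] //=; rewrite !span_cons IHs.
congr (_ + _)%VS; apply/eqP; rewrite eqEsubv -!memvE memvZ ?memv_line //=.
by apply/vlineP; exists (c i)^-1; rewrite scalerA mulVf ?scale1r.
Qed.

Lemma free_map_scale (F : fieldType) (V : vectType F) (I : Type) (c : I -> F)
    (f : I -> V) (s : seq I) : (forall i, c i != 0) ->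
  free [seq c i *: f i | i <- s] = free [seq f i | i <- s].
Proof.
move=> c_neq0; elim: s => [|i s IHs] //=.
by rewrite !free_cons IHs span_map_scale // rpredZeq (negPf (c_neq0 i)).
Qed.

Lemma free_map_inj (F : fieldType) (V W : vectType F) (g : {linear V -> W})
    (X : seq V) : injective g -> free (map g X) = free X.
Proof.
move=> g_inj; have gE : map g X = map (linfun g) X.
  by apply: eq_map => v; rewrite lfunE.
have ker0 : lker (linfun g) == 0%VS.
  by apply/lker0P => u v; rewrite !lfunE; apply: g_inj.
rewrite gE /free -limg_span size_map limg_dim_eq //.
by rewrite (eqP ker0) capv0.
Qed.

Section LineSymmetries.
Variables (F : numFieldType) (theta : involutive_rmorphism F).
Variables (d n : nat).
Implicit Types (x y : 'cV[F]_d) (Phi : 'M[F]_(d, n)) (S : {set 'I_n}).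

Lemma adj_mul_inner x y : y ^t theta *m x = (inner theta x y)%:M.
Proof.
rewrite [LHS]mx11_scalar mxE; congr _%:M; apply: eq_bigr => i _.
by rewrite !mxE mulrC.
Qed.

(** Applying both sides of x x^* = y y^* to y expresses (y^* y) y as a multiple
    of x. *)
Lemma eq_proj_proportional x y : inner theta y y != 0 ->
  x *m x ^t theta = y *m y ^t theta -> exists2 c : F, c != 0 & y = c *: x.
Proof.
move=> yy_neq0 xx_yy.
have y_x : inner theta y y *: y = inner theta y x *: x.
  by rewrite -!mul_mx_scalar -!adj_mul_inner !mulmxA xx_yy.
have y_cx : y = ((inner theta y y)^-1 * inner theta y x) *: x.
  by rewrite -scalerA -y_x scalerA mulVf ?scale1r.
exists ((inner theta y y)^-1 * inner theta y x) => //.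
apply: contra_neq yy_neq0 => c0; rewrite {1}y_cx c0 scale0r /inner.
by rewrite big1 // => i _; rewrite mxE mul0r.
Qed.

Lemma line_symmetry_col Phi (U : 'M[F]_d) (i j : 'I_n) :
  inner theta (col i Phi) (col i Phi) != 0 ->
  U *m line_proj theta Phi j *m U ^t theta = line_proj theta Phi i ->
  exists2 c : F, c != 0 & col i Phi = c *: (U *m col j Phi).
Proof.
move=> ii_neq0 Uji; apply: eq_proj_proportional => //.
by rewrite trmx_mul map_mxM /= -[RHS]Uji /line_proj !mulmxA.
Qed.

Lemma unitary_mx_inj (U : 'M[F]_d) : is_unitary_mx theta U ->
  injective (mulmx U : 'cV[F]_d -> 'cV[F]_d).
Proof.
by move=> /mulmx1C UU1; apply: (can_inj (g := mulmx (U ^t theta))) => x;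
  rewrite mulmxA UU1 mul1mx.
Qed.

Lemma lin_dep_imset Phi (s : 'S_n) S :
  (forall j, inner theta (col j Phi) (col j Phi) != 0) ->
  line_symmetry theta Phi s -> lin_dep Phi (s @: S) = lin_dep Phi S.
Proof.
move=> nz [U U1 sU]; congr (~~ _).
have /choice [c cP] j : exists c : F,
    c != 0 /\ col (s j) Phi = c *: (U *m col j Phi).
  by have [c] := line_symmetry_col (nz (s j)) (sU j); exists c.
have enum_s : perm_eq (enum (s @: S)) (map s (enum S)).
  apply: uniq_perm; rewrite ?enum_uniq ?map_inj_uniq ?enum_uniq //.
    exact: perm_inj.
  move=> i; rewrite mem_enum; apply/imsetP/mapP => -[j jS ->];
    by exists j => //; rewrite ?mem_enum // in jS *.
rewrite (perm_free (perm_map (fun j => col j Phi) enum_s)) -map_comp.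
rewrite (eq_map (g := fun j => c j *: (U *m col j Phi))); last first.
  by move=> j /=; case: (cP j).
rewrite free_map_scale => [|j]; last by case: (cP j).
by rewrite (map_comp (mulmx U)) (free_map_inj _ (unitary_mx_inj U1)).
Qed.

Lemma lin_dep_setT Phi : (d < n)%N -> lin_dep Phi [set: 'I_n].
Proof.
move=> lt_dn; apply: contraL lt_dn => /eqP free_Phi.
rewrite -leqNgt; have := dimvS (subvf <<[seq col j Phi | j in [set: 'I_n]]>>).
by rewrite free_Phi dimvf dim_matrix mulr1 size_image cardsT card_ord.
Qed.

Lemma bender_neq0 Phi : (d < n)%N -> exists S, S \in bender Phi.
Proof.
move=> /lin_dep_setT depT.
exists [arg min_(S < [set: 'I_n] | lin_dep Phi S) #|S|]%N.
by rewrite inE eqxx; case: arg_minnP.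
Qed.

End LineSymmetries.

(** An element s of G maps the blocks containing A injectively to blocks
    containing s(A). Homogeneity supplies such an s from any k-set to any other,
    in both directions, which makes the counts equal; a k-subset of an existing
    block shows that the common count is positive. *)
Lemma homogeneous_design (T : finType) (G : {group {perm T}}) (k m : nat)
    (B : {set {set T}}) :
  homogeneous G k -> (k <= m)%N -> B != set0 ->
  (forall b, b \in B -> #|b| = m) ->
  (forall (s : {perm T}) b, s \in G -> b \in B -> s @: b \in B) ->
  exists lambda, is_design k #|T| m lambda B.
Proof.
move=> homG le_km /set0Pn [b0 Bb0] sizeB stableB.
pose count (A : {set T}) := #|[set b in B | A \subset b]|.
have le_count (A A' : {set T}) : #|A| = k -> #|A'| = k -> (count A <= count A')%N.
  move=> cardA cardA'; have [s Gs <-] := homG _ _ cardA cardA'.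
  rewrite /count -(card_imset _ (imset_inj (@perm_inj _ s))); apply: subset_leq_card.
  apply/subsetP => _ /imsetP [b + ->]; rewrite !inE => /andP [Bb sAb].
  by rewrite stableB ?imsetS.
have /card_geqP [t [uniq_t size_t sub_t]] : (k <= #|b0|)%N by rewrite sizeB.
pose A0 := [set x in t].
have cardA0 : #|A0| = k by rewrite cardsE (card_uniqP uniq_t).
exists (count A0); split=> // [|A cardA]; last first.
  by apply/eqP; rewrite eqn_leq !le_count.
rewrite card_gt0; apply/set0Pn; exists b0; rewrite inE Bb0.
by apply/subsetP => x; rewrite inE => /sub_t.
Qed.

(** The conjugation theta is arbitrary, so that the real and the complex case
    are both instances. *)
Lemma etf_bender_design (F : numFieldType) (theta : involutive_rmorphism F)
    (d n k : nat) (Phi : 'M[F]_(d, n)) :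
  (d < n)%N -> is_etf theta Phi ->
  homogeneous (line_symmetry_group theta Phi) k -> (k <= spark Phi)%N ->
  exists lambda : nat, is_design k n (spark Phi) lambda (bender Phi).
Proof.
move=> lt_dn [_ [a [b [_ b_gt0 innerE]]] _] homG le_k.
have nz j : inner theta (col j Phi) (col j Phi) != 0.
  by rewrite -normr_gt0 innerE eqxx mulr1 subrK.
rewrite -{1}[n]card_ord; apply: homogeneous_design homG le_k _ _ _.
- by apply/set0Pn; apply: bender_neq0.
- by move=> S; rewrite inE => /andP [/eqP].
- move=> s S; rewrite inE => /asboolP symm_s; rewrite !inE.
  by rewrite (card_imset _ (@perm_inj _ s)) (lin_dep_imset _ nz symm_s).
Qed.

Theorem proposition1p23 (R : realType) (d n k : nat)
    (hk : (1 <= k)%N) (hdn : (d < n)%N) :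
  (forall Phi : 'M[R]_(d, n),
     is_etf (@idfun R) Phi ->
     homogeneous (line_symmetry_group (@idfun R) Phi) k ->
     (k <= spark Phi)%N ->
     exists lambda : nat, is_design k n (spark Phi) lambda (bender Phi))
  /\
  (forall Phi : 'M[R[i]]_(d, n),
     is_etf (@Num.conj R[i]) Phi ->
     homogeneous (line_symmetry_group (@Num.conj R[i]) Phi) k ->
     (k <= spark Phi)%N ->
     exists lambda : nat, is_design k n (spark Phi) lambda (bender Phi)).
Proof. by split=> Phi; apply: etf_bender_design. Qed.
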